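(* Assume (H0), (H1) and $H\in C^1(\mathbb{R}^n)$. Let $u(t,x)=\min_{y\in\mathbb{R}^n}\{\sigma(y)+tH^*(\frac{x-y}{t})\}$ on $\Omega=(0,T)\times\mathbb{R}^n$. Suppose that there exists $t_*\in(0,T)$ such that, for every $x\in\mathbb{R}^n$, all generalized characteristic curves passing through $(t_*,x)$ are of type (I) at $(t_*,x)$. Then $u$ is continuously differentiable on the open strip $(0,t_* )\times\mathbb{R}^n$.
   Context: Let $T>0$, $H:\mathbb{R}^n\to\mathbb{R}$, $\sigma:\mathbb{R}^n\to\mathbb{R}$. $H^*(z)=\max_{y\in\mathbb{R}^n}\{\langle z,y\rangle-H(y)\}$ is the Fenchel conjugate of $H$; $H_p$ denotes the gradient of $H$. (H0): $H$ is strictly convex on $\mathbb{R}^n$ and superlinear, i.e. $\lim_{\|p\|\to\infty}H(p)/\|p\|=+\infty$. (H1): $\sigma$ is continuous on $\mathbb{R}^n$ and for every $(t_0,x_0)\in[0,T)\times\mathbb{R}^n$ there exist constants $r,N>0$ such that $\min_{\|y\|\le N}\{\sigma(y)+tH^*(\frac{x-y}{t})\}<\sigma(z)+tH^*(\frac{x-z}{t})$ whenever $\|z\|>N$, $t\in(0,T)$ and $|t-t_0|+\|x-x_0\|<r$. The function $u$ is the viscosity solution, given by the Hopf-Lax formula, of $u_t+H(D_xu)=0$ in $\Omega$, $u(0,x)=\sigma(x)$. For $(t,x)\in\Omega$, $\ell(t,x)$ is the set of global minimizers over $y\in\mathbb{R}^n$ of $y\mapsto\sigma(y)+tH^*(\frac{x-y}{t})$.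 Set $D^+\sigma(y)=\{p:\limsup_{h\to0}\frac{\sigma(y+h)-\sigma(y)-\langle p,h\rangle}{|h|}\le0\}$ and $D^-\sigma(y)=\{p:\liminf_{h\to0}\frac{\sigma(y+h)-\sigma(y)-\langle p,h\rangle}{|h|}\ge0\}$; $D^\#\sigma(y)=D^+\sigma(y)\cup D^-\sigma(y)$ if nonempty, and $D^\#\sigma(y)=\{0\}$ otherwise. A generalized characteristic curve is a curve $x(t)=y+tH_p(q)$, $t\in[0,T]$, where $y\in\mathbb{R}^n$ and $q\in D^\#\sigma(y)$. If it passes through $(t_0,x_0)$, i.e. $x_0=y+t_0H_p(q)$, it is of type (I) at $(t_0,x_0)$ if $y\in\ell(t_0,x_0)$, and of type (II) at $(t_0,x_0)$ otherwise. *)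

(* Defs.v *)
From mathcomp Require Import all_boot all_order all_algebra.
From mathcomp Require Import all_classical all_reals all_analysis.
Set Implicit Arguments.
Unset Strict Implicit.
Unset Printing Implicit Defensive.
Import Order.TTheory GRing.Theory Num.Theory.
Import numFieldNormedType.Exports.
Local Open Scope classical_set_scope.
Local Open Scope ring_scope.

(* The library norm on 'rV[R]_n is the sup norm. It gives the usual topology
   and derivatives; vector norms in the hypotheses are the Euclidean [enorm]. *)

Definition dotr (R : realType) (n : nat) (x y : 'rV[R]_n) : R :=
  \sum_(i < n) x ord0 i * y ord0 i.

Definition enorm (R : realType) (n : nat) (x : 'rV[R]_n) : R :=
  Num.sqrt (dotr x x).

Definition grad (R : realType) (n : nat) (f : 'rV[R]_n -> R) (p : 'rV[R]_n) :
    'rV[R]_n :=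
  \row_(i < n) 'D_(delta_mx ord0 i) f p.

(* The second clause is continuity of z |-> 'd f z for the operator norm. It
   refers to values of 'd f at all z near x, so A is meant to be open. *)
Definition C1_on (R : realType) (V : normedModType R) (A : set V) (f : V -> R) :
    Prop :=
  (forall x, A x -> differentiable f x) /\
  (forall x, A x -> forall e : R, 0 < e ->
     \forall z \near x, forall v : V, `|'d f z v - 'd f x v| <= e * `|v|).

Definition strictly_convex (R : realType) (n : nat) (f : 'rV[R]_n -> R) : Prop :=
  forall (x y : 'rV[R]_n) (s : R), x != y -> 0 < s -> s < 1 ->
    f (s *: x + (1 - s) *: y) < s * f x + (1 - s) * f y.

Definition superlinear (R : realType) (n : nat) (f : 'rV[R]_n -> R) : Prop :=
  forall A : R, exists M : R, forall p : 'rV[R]_n,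
    M < enorm p -> A < f p / enorm p.

Definition condH0 (R : realType) (n : nat) (H : 'rV[R]_n -> R) : Prop :=
  strictly_convex H /\ superlinear H.

(* The real [sup] and [inf] below are junk for unbounded sets; under (H0) and
   (H1) (with t > 0) they are bounded and attained, i.e. the max and min of
   the Fenchel conjugate and of the Hopf-Lax formula. *)
Definition fenchel (R : realType) (n : nat) (H : 'rV[R]_n -> R)
    (z : 'rV[R]_n) : R :=
  sup [set dotr z y - H y | y in [set: 'rV[R]_n]].

Definition hopf_lax_cost (R : realType) (n : nat) (H sigma : 'rV[R]_n -> R)
    (t : R) (x y : 'rV[R]_n) : R :=
  sigma y + t * fenchel H (t^-1 *: (x - y)).

Definition condH1 (R : realType) (n : nat) (T : R) (H sigma : 'rV[R]_n -> R) :
    Prop :=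
  continuous sigma /\
  forall (t0 : R) (x0 : 'rV[R]_n), 0 <= t0 -> t0 < T ->
    exists r N : R, [/\ 0 < r, 0 < N &
      forall (t : R) (x z : 'rV[R]_n), N < enorm z -> 0 < t -> t < T ->
        `|t - t0| + enorm (x - x0) < r ->
        inf [set hopf_lax_cost H sigma t x y | y in [set y | enorm y <= N]]
          < hopf_lax_cost H sigma t x z].

(* Uncurried, so as to be a function on the normed space R * R^n. *)
Definition hopf_lax (R : realType) (n : nat) (H sigma : 'rV[R]_n -> R)
    (tx : R * 'rV[R]_n) : R :=
  inf [set hopf_lax_cost H sigma tx.1 tx.2 y | y in [set: 'rV[R]_n]].

Definition ell (R : realType) (n : nat) (H sigma : 'rV[R]_n -> R)
    (t : R) (x : 'rV[R]_n) : set 'rV[R]_n :=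
  [set y | forall z : 'rV[R]_n,
     hopf_lax_cost H sigma t x y <= hopf_lax_cost H sigma t x z].

Definition diff_quot (R : realType) (n : nat) (sigma : 'rV[R]_n -> R)
    (y p h : 'rV[R]_n) : \bar R :=
  ((sigma (y + h) - sigma y - dotr p h) / enorm h)%:E.

Definition Dplus (R : realType) (n : nat) (sigma : 'rV[R]_n -> R)
    (y : 'rV[R]_n) : set 'rV[R]_n :=
  [set p | (limf_esup (diff_quot sigma y p) (dnbhs (0%R : 'rV[R]_n)) <= 0)%E].

Definition Dminus (R : realType) (n : nat) (sigma : 'rV[R]_n -> R)
    (y : 'rV[R]_n) : set 'rV[R]_n :=
  [set p | (0 <= limf_einf (diff_quot sigma y p) (dnbhs (0%R : 'rV[R]_n)))%E].

Definition Dsharp (R : realType) (n : nat) (sigma : 'rV[R]_n -> R)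
    (y : 'rV[R]_n) : set 'rV[R]_n :=
  let D := Dplus sigma y `|` Dminus sigma y in
  if `[< D !=set0 >] then D else [set 0].

Definition char_curve (R : realType) (n : nat) (H : 'rV[R]_n -> R)
    (y q : 'rV[R]_n) (t : R) : 'rV[R]_n :=
  y + t *: grad H q.

Definition gen_char (R : realType) (n : nat) (T : R)
    (H sigma : 'rV[R]_n -> R) (c : R -> 'rV[R]_n) : Prop :=
  exists y q : 'rV[R]_n, Dsharp sigma y q /\
    forall t : R, 0 <= t -> t <= T -> c t = char_curve H y q t.

(* A generalized characteristic c starting at y has c 0 = y. *)
Definition type_I (R : realType) (n : nat) (H sigma : 'rV[R]_n -> R)
    (c : R -> 'rV[R]_n) (t0 : R) (x0 : 'rV[R]_n) : Prop :=
  c t0 = x0 /\ ell H sigma t0 x0 (c 0).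

(* Main.v *)
Require Import Defs.
From HB Require Import structures.
From mathcomp Require Import all_boot all_order all_algebra.
From mathcomp Require Import all_classical all_reals all_analysis.
From mathcomp Require Import ring lra.
Import Order.TTheory GRing.Theory Num.Theory.
Import numFieldNormedType.Exports.
Local Open Scope classical_set_scope.
Local Open Scope ring_scope.
Set Implicit Arguments.
Unset Strict Implicit.
Unset Printing Implicit Defensive.

(** Write H* for the Fenchel conjugate of H, and P(z) for the maximizer of
    p |-> <z, p> - H(p): it exists by superlinearity, is unique by strict
    convexity, depends continuously on z, and satisfies H_p(P(z)) = z because
    H is differentiable. The map P stands in for the gradient of H*.

    Step 1: minimizers propagate. Let y be in ell(t0, x0) with 0 < t0 < tstar,
    let v = (x0 - y) / t0 and q = P(v). Comparing the minimizer y with y + h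
    shows that q lies in D^- sigma(y) ([ell_Dminus]), so y + t H_p(q) = y + t v
    is a generalized characteristic. It passes through (t0, x0) and through
    (tstar, x1), x1 = y + tstar v, where it is of type (I) by hypothesis: y is
    in ell(tstar, x1).

    Step 2: before a time at which it is still minimizing, a characteristic
    carries the only minimizer ([ell_unique]). If z is also in ell(t0, x0),
    going from z to x0 and then along the characteristic to x1 costs no more
    than the optimal path from y to x1. So the convexity inequality for H* at
    the broken path from z is an equality: a single momentum p is optimal for
    both velocities (x0 - z) / t0 and v. As H is differentiable, both are
    H_p(p), hence z = y.

    Step 3: a unique minimizer gives regularity ([hopf_lax_C1]). By (H1) the
    minimizers are locally bounded, so the unique minimizer y(t, x) is
    continuous ([argmin_cvg]). Testing the minimum at one point with the
    minimizer at the other bounds the increment of u on both sides by affine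
    forms <q, dx> - H(q) dt ([hopf_lax_increment_le]), whose momenta q converge
    to p(t, x) = P((x - y(t, x)) / t). So u is differentiable with
    D_x u = p(t, x) and u_t = - H(p(t, x)), and these are continuous. *)

(** * The scalar product and the Euclidean norm *)

Section Dot.
Context {R : realType} {n : nat}.
Implicit Types x y z p : 'rV[R]_n.

Lemma dotrDr p x y : dotr p (x + y) = dotr p x + dotr p y.
Proof. by rewrite /dotr -big_split; apply: eq_bigr => i _; rewrite mxE mulrDr. Qed.

Lemma dotrZr p (a : R) x : dotr p (a *: x) = a * dotr p x.
Proof. by rewrite /dotr mulr_sumr; apply: eq_bigr => i _; rewrite mxE mulrCA. Qed.

Lemma dotrC x y : dotr x y = dotr y x.
Proof. by apply: eq_bigr => i _; rewrite mulrC. Qed.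

Lemma dotrBr p x y : dotr p (x - y) = dotr p x - dotr p y.
Proof. by rewrite dotrDr -scaleN1r dotrZr mulN1r. Qed.

Lemma dotrBl p q x : dotr (p - q) x = dotr p x - dotr q x.
Proof. by rewrite dotrC dotrBr !(dotrC x). Qed.

Lemma dotr0 p : dotr p 0 = 0.
Proof. by rewrite -(scale0r 0) dotrZr mul0r. Qed.

Lemma dotr_delta p i : dotr p (delta_mx ord0 i) = p ord0 i.
Proof.
rewrite /dotr (bigD1 i) //= mxE !eqxx mulr1 big1 ?addr0 // => j ji.
by rewrite mxE (negbTE ji) andbF mulr0.
Qed.

Lemma normr_coord_le x i : `|x ord0 i| <= `|x|.
Proof.
by rewrite [leRHS]/Num.norm /= mx_normrE; apply: (le_bigmax_cond _ (fun ij => `|x ij.1 ij.2|) (j := (ord0, i))).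
Qed.

(** A crude Cauchy-Schwarz inequality for the sup norm: the factor n is
    harmless, since only continuity and coercivity are extracted from it. *)
Lemma normr_dotr_le x y : `|dotr x y| <= n%:R * `|x| * `|y|.
Proof.
rewrite (le_trans (ler_norm_sum _ _ _))// -mulrA.
rewrite (le_trans (y := \sum_(i < n) `|x| * `|y|))//; last first.
  by rewrite sumr_const card_ord mulr_natl.
by apply: ler_sum => i _; rewrite normrM ler_pM// normr_coord_le.
Qed.

Lemma dotrr_ge0 x : 0 <= dotr x x.
Proof. by apply: sumr_ge0 => i _; rewrite -expr2 sqr_ge0. Qed.

Lemma normr_le_enorm x : `|x| <= enorm x.
Proof.
rewrite [leLHS]/Num.norm /= mx_normrE; apply: bigmax_le => [|[k i] _] /=; first exact: sqrtr_ge0.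
rewrite (ord1 k) -sqrtr_sqr ler_sqrt ?dotrr_ge0// expr2 /dotr (bigD1 i)//=.
by rewrite lerDl sumr_ge0 // => j _; rewrite -expr2 sqr_ge0.
Qed.

Lemma dotr_cvg (T : Type) (F : set_system T) {FF : Filter F} (f g : T -> 'rV[R]_n) a b :
  f @ F --> a -> g @ F --> b -> dotr (f x) (g x) @[x --> F] --> dotr a b.
Proof.
move=> fa gb; rewrite /dotr.
apply: (cvg_big add_continuous) => i _; apply: cvgM.
- by apply: (cvg_comp f (fun x : 'rV[R]_n => x ord0 i) fa); exact: coord_continuous.
- by apply: (cvg_comp g (fun x : 'rV[R]_n => x ord0 i) gb); exact: coord_continuous.
Qed.

Lemma dotr_continuous p : continuous (dotr p).
Proof. by move=> x; exact: (@dotr_cvg _ (nbhs x) _ (fun=> p) id p x (cvg_cst p)). Qed.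

Lemma enorm_continuous : continuous (@enorm R n).
Proof.
move=> x; rewrite /continuous_at /enorm.
apply: (cvg_comp (fun x => dotr x x) Num.sqrt); last exact: sqrt_continuous.
exact: (@dotr_cvg _ (nbhs x) _ id id x x).
Qed.

Lemma compact_enorm_ball (N : R) : compact [set y : 'rV[R]_n | enorm y <= N].
Proof.
apply: bounded_closed_compact.
  exists N; split=> [|M NM y /= yN]; first exact: num_real.
  by rewrite (le_trans (normr_le_enorm y))// (le_trans yN)// ltW.
have /continuous_closedP/(_ _ (@closed_le _ N)) := @enorm_continuous.
by [].
Qed.

End Dot.

(** * Continuity of a unique minimizer *)

(** Every point y of K other than y0 has a neighbourhood on which f(x, .) stays
    above f(x, y0) for x close to x0. By compactness, finitely many of these
    neighbourhoods cover K away from y0, so they exclude all of it as a place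
    for m(x) at once, for x close to x0. *)
Lemma argmin_cvg (X Y : topologicalType) (R : realType) (f : X -> Y -> R)
    (K : set Y) (m : X -> Y) (x0 : X) (y0 : Y) :
  compact K ->
  (forall y, K y -> {for (x0, y), continuous (fun xy => f xy.1 xy.2)}) ->
  (\forall x \near x0, K (m x) /\ f x (m x) <= f x y0) ->
  K y0 -> (forall y, K y -> f x0 y <= f x0 y0 -> y = y0) ->
  m @ x0 --> y0.
Proof.
move=> /compact_near_coveringP cK cf mK Ky0 uniq U Uy0.
rewrite nbhs_filterE.
have : \forall x \near x0, K `<=` (fun y => y = m x -> f x (m x) <= f x y0 -> U y).
  apply: (cK X (nbhs x0) (fun x y => y = m x -> f x (m x) <= f x y0 -> U y)) => y Ky.
  have [->|/eqP yy0] := eqVneq y y0.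
    by exists (U, setT) => /=; [split=> //; exact: filterT | move=> [y' x] /= [Uy _] _ _].
  have lt : f x0 y0 < f x0 y.
    by rewrite ltNge; apply/negP => /(uniq _ Ky).
  have c1 : f x'.2 x'.1 @[x' --> (y, x0)] --> f x0 y.
    apply: (cvg_comp (fun x' : Y * X => (x'.2, x'.1)) (fun xy => f xy.1 xy.2)); last exact: cf.
    by apply: cvg_pair; [exact: cvg_snd | exact: cvg_fst].
  have c2 : f x'.2 y0 @[x' --> (y, x0)] --> f x0 y0.
    apply: (cvg_comp (fun x' : Y * X => (x'.2, y0)) (fun xy => f xy.1 xy.2)); last exact: cf.
    by apply: cvg_pair; [exact: cvg_snd | exact: cvg_cst].
  have : \forall x' \near (y, x0), 0 < f x'.2 x'.1 - f x'.2 y0.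
    by apply: (cvgr_gt _ (cvgB c1 c2)); rewrite subr_gt0.
  apply: filterS => -[y' x] /=; rewrite subr_gt0 => + yE.
  by rewrite -yE => /lt_geF ->.
move=> nK; apply: filterS2 nK mK => x + [Kx lex] /=.
by move=> /(_ _ Kx); exact.
Qed.

(** * Maximizers in the Fenchel conjugate *)

Section Fenchel.
Context {R : realType} {n : nat} (H : 'rV[R]_n -> R).
Implicit Types z p q : 'rV[R]_n.

(** For convex H this says that p is a subgradient at z of the conjugate of H. *)
Definition fenchel_argmax z p := forall q, dotr z q - H q <= dotr z p - H p.

Lemma fenchelE z p : fenchel_argmax z p -> fenchel H z = dotr z p - H p.
Proof.
move=> pmax; apply/eqP; rewrite eq_le; apply/andP; split.
  by apply: ge_sup => [|_ [q _ <-]//]; exists (dotr z p - H p), p.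
by apply: ub_le_sup; [exists (dotr z p - H p) => _ [q _ <-] | exists p].
Qed.

Hypothesis H_superlinear : superlinear H.

(** Superlinearity confines the maximizers to a ball that can be chosen
    uniformly for bounded z; outside it, even the momentum 0 does better. *)
Lemma fenchel_coercive (C : R) : exists2 M, 0 <= M &
  forall z p, `|z| <= C -> M < enorm p -> dotr z p - H p < - H 0.
Proof.
(* n C enorm p bounds the scalar product; the extra enorm p exceeds H 0. *)
have [M0 HM0] := H_superlinear (n%:R * C + 1).
exists (Num.max 0 (Num.max `|H 0| M0)) => [|z p zC]; first by rewrite le_max lexx.
rewrite !gt_max => /and3P[p0 pH /HM0].
rewrite ltr_pdivlMr// => Hp.
have zp : dotr z p <= n%:R * C * enorm p.
  rewrite (le_trans (ler_norm _))// (le_trans (normr_dotr_le _ _))//.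
  by rewrite ler_pM// ?mulr_ge0// ?ler_wpM2l// normr_le_enorm.
have := ler_norm (H 0).
lra.
Qed.

Hypothesis H_cont : continuous H.

Lemma fenchel_argmax_exists z : exists p, fenchel_argmax z p.
Proof.
have [M M0 HM] := fenchel_coercive `|z|.
have cont : continuous (fun p => dotr z p - H p).
  move=> p; exact: (cvgB (@dotr_continuous _ _ z p) (@H_cont p)).
have B0 : [set y : 'rV[R]_n | enorm y <= M] 0 by rewrite /= /enorm dotr0 sqrtr0.
have [|p _ pmax] := EVT_max_rV _ (@compact_enorm_ball R n M) (continuous_subspaceT cont).
  by exists 0.
exists p => q; have [qM|/HM qM] := lerP (enorm q) M; first by rewrite pmax ?inE.
have := pmax 0; rewrite inE dotr0 sub0r => /(_ B0).
by apply: le_trans; rewrite ltW// qM.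
Qed.

Lemma fenchel_ge z p : dotr z p - H p <= fenchel H z.
Proof. by have [q qmax] := fenchel_argmax_exists z; rewrite (fenchelE qmax). Qed.

Lemma fenchel_eq_argmax z p : fenchel H z <= dotr z p - H p -> fenchel_argmax z p.
Proof. by move=> le q; rewrite (le_trans (fenchel_ge z q)). Qed.

(** First-order condition: H(p + h e_i) - H(p) >= h z_i for h of either sign,
    so the partial derivative lies both above and below z_i. *)
Lemma fenchel_argmax_grad z p :
  differentiable H p -> fenchel_argmax z p -> grad H p = z.
Proof.
move=> dH pmax; apply/rowP => i; rewrite mxE.
set e := delta_mx ord0 i.
have /cvg_ex [l Hl] := diff_derivable (v := e) dH.
have lE : 'D_e H p = l by apply: cvg_lim Hl.
have slope (h : R) : h * z ord0 i <= H (h *: e + p) - H p.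
  have := pmax (h *: e + p); rewrite dotrDr dotrZr dotr_delta.
  lra.
apply/eqP; rewrite lE eq_le; apply/andP; split.
- apply: (cvgr_to_le (F := 0^'-) (f := fun h : R => h^-1 *: (H (h *: e + p) - H p))).
    exact: cvg_dnbhs_at_left Hl.
  near=> h; have h0 : h < 0 by near: h; exact: nbhs_left_lt.
  by rewrite /GRing.scale/= ler_ndivrMl.
- apply: (cvgr_to_ge (F := 0^'+) (f := fun h : R => h^-1 *: (H (h *: e + p) - H p))).
    exact: cvg_dnbhs_at_right Hl.
  near=> h; have h0 : 0 < h by near: h; exact: nbhs_right_gt.
  by rewrite /GRing.scale/= ler_pdivlMl.
Unshelve. all: by end_near. Qed.

Hypothesis H_convex : strictly_convex H.

(** The midpoint of two distinct maximizers would do strictly better. *)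
Lemma fenchel_argmax_unique z p q :
  fenchel_argmax z p -> fenchel_argmax z q -> p = q.
Proof.
move=> pmax qmax; apply/eqP; apply: contraT => pq.
have := H_convex pq (s := 2^-1).
rewrite invr_gt0 ltr0n invf_lt1 ?ltr1n// => /(_ isT isT) lt.
have := pmax (2^-1 *: p + (1 - 2^-1) *: q); have := qmax p.
rewrite dotrDr !dotrZr; lra.
Qed.

Lemma fenchel_argmax_continuous (P : 'rV[R]_n -> 'rV[R]_n) :
  (forall z, fenchel_argmax z (P z)) -> continuous P.
Proof.
move=> PH z.
have [M M0 HM] := fenchel_coercive (`|z| + 1).
have PM z' : `|z'| <= `|z| + 1 -> enorm (P z') <= M.
  move=> /HM bd; rewrite leNgt; apply/negP => /bd.
  by rewrite ltNge (le_trans _ (PH z' 0))// dotr0 sub0r.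
apply: (argmin_cvg (f := fun z p => H p - dotr z p) (@compact_enorm_ball R n M)).
- move=> p _; apply: (@cvgB _ _ _ (nbhs (z, p))).
    exact: (cvg_comp snd H cvg_snd (@H_cont p)).
  exact: (@dotr_cvg _ _ _ (nbhs (z, p)) _ fst snd z p cvg_fst cvg_snd).
- have : \forall z' \near z, `|z'| < `|z| + 1.
    by apply: (cvgr_lt _ (@norm_continuous _ _ z)); rewrite ltrDl.
  apply: filterS => z' /ltW/PM ?; split=> //.
  have := PH z' (P z); lra.
- by apply: PM; rewrite lerDl.
- move=> p _ le; apply: fenchel_argmax_unique (PH z) => q.
  have := PH z q; lra.
Qed.

Lemma fenchel_continuous : continuous (fenchel H).
Proof.
have [P PH] := choice fenchel_argmax_exists.
have cP := fenchel_argmax_continuous PH.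
rewrite (_ : fenchel H = fun z => dotr z (P z) - H (P z)); last first.
  by apply/funext => z; exact: fenchelE.
move=> z; apply: (@cvgB _ _ _ (nbhs z)).
  exact: (@dotr_cvg _ _ _ (nbhs z) _ id P z (P z) _ (cP z)).
exact: (cvg_comp P H (cP z) (@H_cont (P z))).
Qed.

End Fenchel.

(** * Minimizers in the Hopf-Lax formula *)

Lemma limf_einf_ge (T : choiceType) (X : filteredType T) (R : realType)
    (f : X -> \bar R) (F : set_system X) (a : R) :
  (forall e, 0 < e -> F [set x | (a%:E - e%:E <= f x)%E]) ->
  (a%:E <= limf_einf f F)%E.
Proof.
move=> fF; apply/lee_subgt0Pr => e /fF FV; rewrite limf_einfE.
apply: (@le_trans _ _ (ereal_inf (f @` [set x | (a%:E - e%:E <= f x)%E]))).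
  by apply: le_ereal_inf_tmp => _ [x ? <-].
by apply: ereal_sup_ubound; exists [set x | (a%:E - e%:E <= f x)%E].
Qed.

Lemma velocity_cvg (R : realType) (n : nat) (T : Type) (F : set_system T) {FF : Filter F}
    (s : T -> R) (a b : T -> 'rV[R]_n) (s0 : R) (a0 b0 : 'rV[R]_n) : s0 != 0 ->
  s @ F --> s0 -> a @ F --> a0 -> b @ F --> b0 ->
  (s u)^-1 *: (a u - b u) @[u --> F] --> s0^-1 *: (a0 - b0).
Proof. by move=> s0N cs ca cb; exact: (cvgZ (cvgV s0N cs) (cvgB ca cb)). Qed.

Section HopfLax.
Context {R : realType} {n : nat} (H sigma : 'rV[R]_n -> R).
Hypotheses (H_superlinear : superlinear H) (H_cont : continuous H).
Implicit Types (t : R) (x y z p : 'rV[R]_n).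

Let scaled_dual t x p : 0 < t ->
  t * (dotr (t^-1 *: x) p - H p) = dotr p x - t * H p.
Proof. by move=> t0; rewrite (dotrC _ p) dotrZr mulrBr mulrA divff ?gt_eqF// mul1r. Qed.

(** Fenchel's inequality, multiplied by t: every momentum p gives a lower bound
    of the cost that is affine in (t, x), with equality for the maximizing p. *)
Lemma hopf_lax_cost_ge t x y p : 0 < t ->
  sigma y + (dotr p (x - y) - t * H p) <= hopf_lax_cost H sigma t x y.
Proof. by move=> t0; rewrite lerD2l -scaled_dual// ler_pM2l// fenchel_ge. Qed.

Lemma hopf_lax_costE t x y p : 0 < t -> fenchel_argmax H (t^-1 *: (x - y)) p ->
  hopf_lax_cost H sigma t x y = sigma y + (dotr p (x - y) - t * H p).
Proof. by move=> t0 pmax; rewrite /hopf_lax_cost (fenchelE pmax) scaled_dual. Qed.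

Lemma hopf_lax_ell t x y :
  ell H sigma t x y -> hopf_lax H sigma (t, x) = hopf_lax_cost H sigma t x y.
Proof.
move=> yl; apply/eqP; rewrite eq_le; apply/andP; split.
  by apply: ge_inf; [exists (hopf_lax_cost H sigma t x y) => _ [z _ <-] | exists y].
by apply: lb_le_inf => [|_ [z _ <-]//]; exists (hopf_lax_cost H sigma t x y), y.
Qed.

(** The minimizer y for (t, x) is a competitor at (t', x'). Its cost there is
    computed with the momentum p, and its cost at (t, x) is bounded below with
    the same p, so that sigma(y) cancels. Exchanging the two points gives the
    opposite inequality, with another momentum. *)
Lemma hopf_lax_increment_le t x y t' x' y' p : 0 < t -> 0 < t' ->
  ell H sigma t x y -> ell H sigma t' x' y' ->
  fenchel_argmax H (t'^-1 *: (x' - y)) p ->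
  hopf_lax H sigma (t', x') - hopf_lax H sigma (t, x)
    <= dotr p (x' - x) - (t' - t) * H p.
Proof.
move=> t0 t'0 yl y'l pmax; rewrite (hopf_lax_ell yl) (hopf_lax_ell y'l).
have := y'l y; rewrite (hopf_lax_costE t'0 pmax).
have := hopf_lax_cost_ge x y p t0; rewrite !dotrBr.
lra.
Qed.

(** The mean velocity (x1 - z) / t1 of the broken path from z through x0 to x1
    is a convex combination of w = (x0 - z) / t0 and v. As y is optimal at both
    times, the broken path costs no more than the straight one from y to x1, so
    the momentum p that is maximal for the mean velocity is maximal for v and
    for w as well. The gradient of H at p is then equal to both. *)
Lemma ell_unique t0 x0 t1 y z : (forall p, differentiable H p) ->
  0 < t0 -> t0 < t1 ->
  ell H sigma t0 x0 y -> ell H sigma t1 (y + t1 *: (t0^-1 *: (x0 - y))) y ->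
  ell H sigma t0 x0 z -> z = y.
Proof.
move=> dH t0_gt0 t01 yl0 yl1 zl0.
have t1_gt0 : 0 < t1 by exact: lt_trans t01.
have t0N0 : t0 != 0 by rewrite gt_eqF.
set v := t0^-1 *: (x0 - y) in yl1 *; set x1 := y + _ in yl1.
set w := t0^-1 *: (x0 - z).
have [p pmax] := fenchel_argmax_exists H_superlinear H_cont (t1^-1 *: (x1 - z)).
have x0E : x0 = y + t0 *: v by rewrite /v scalerA divff// scale1r addrC subrK.
have x0zE : x0 - z = t0 *: w by rewrite /w scalerA divff// scale1r.
have x1E : x1 - z = t0 *: w + (t1 - t0) *: v.
  by rewrite -x0zE scalerBl /x1 {1}x0E; apply/rowP => i; rewrite !mxE; ring.
have cost1y : hopf_lax_cost H sigma t1 x1 y = sigma y + t1 * fenchel H v.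
  rewrite /hopf_lax_cost; congr (_ + _ * fenchel H _).
  by rewrite /x1 addrC addKr scalerA mulVf ?gt_eqF// scale1r.
have := yl1 z; rewrite cost1y (hopf_lax_costE t1_gt0 pmax) x1E dotrDr (dotrZr p t0) (dotrZr p (t1 - t0)).
have := zl0 y; rewrite /hopf_lax_cost -/v -/w => le0 le1.
have vp := fenchel_ge H_superlinear H_cont v p.
have wp := fenchel_ge H_superlinear H_cont w p.
rewrite (dotrC _ p) in vp; rewrite (dotrC _ p) in wp.
(* The sum of these two Fenchel gaps is nonpositive by le0 and le1. *)
have a0 : 0 <= (t1 - t0) * (fenchel H v - (dotr p v - H p)).
  by rewrite mulr_ge0// subr_ge0// ltW.
have b0 : 0 <= t0 * (fenchel H w - (dotr p w - H p)).
  by rewrite mulr_ge0// ?subr_ge0// ltW.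
have vmax : fenchel_argmax H v p.
  apply: fenchel_eq_argmax => //; rewrite (dotrC _ p) -subr_le0.
  by rewrite -(pmulr_rle0 _ (_ : 0 < t1 - t0)) ?subr_gt0//; lra.
have wmax : fenchel_argmax H w p.
  apply: fenchel_eq_argmax => //; rewrite (dotrC _ p) -subr_le0.
  by rewrite -(pmulr_rle0 _ t0_gt0); lra.
have vw : v = w by rewrite -(fenchel_argmax_grad (dH p) vmax) (fenchel_argmax_grad (dH p) wmax).
apply/oppr_inj/(addrI x0); rewrite x0zE -vw /v scalerA divff// scale1r//.
Qed.

Hypothesis H_convex : strictly_convex H.
Variable P : 'rV[R]_n -> 'rV[R]_n.
Hypothesis PH : forall z, fenchel_argmax H z (P z).

Let P_cont : continuous P.
Proof. exact: fenchel_argmax_continuous. Qed.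

(** Minimality of y gives sigma(y + h) - sigma(y) >= <p'(h), h>, where p'(h) is
    the maximizing momentum of the competitor y + h, and p'(h) tends to p as h
    tends to 0. *)
Lemma ell_Dminus t x y : 0 < t -> ell H sigma t x y ->
  Dminus sigma y (P (t^-1 *: (x - y))).
Proof.
move=> t0 yl; rewrite /Dminus /=; apply: limf_einf_ge => e e0.
set p := P _.
pose p' (h : 'rV[R]_n) := P (t^-1 *: (x - (y + h))).
have p'p : p' h @[h --> (0 : 'rV[R]_n)] --> p.
  rewrite /p -[X in x - X]addr0.
  apply: (cvg_comp (fun h => t^-1 *: (x - (y + h))) P _ (@P_cont _)).
  apply: (@velocity_cvg _ _ _ (nbhs (0 : 'rV[R]_n)) _ (fun=> t) (fun=> x) (fun h => y + h)).
  - by rewrite gt_eqF.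
  - exact: cvg_cst.
  - exact: cvg_cst.
  - exact: (@cvgD _ _ _ (nbhs (0 : 'rV[R]_n)) _ (fun=> y) id y 0 (cvg_cst y)).
(* n.+1 absorbs the factor n of [normr_dotr_le] and is nonzero for n = 0. *)
have en : 0 < e / n.+1%:R by rewrite divr_gt0.
have near_p : \forall h \near (0 : 'rV[R]_n)^', `|p - p' h| <= e / n.+1%:R.
  by apply: nbhs_dnbhs; exact: (@cvgr_dist_le _ _ _ (nbhs (0 : 'rV[R]_n)) _ _ _ p'p).
have near_n0 : \forall h \near (0 : 'rV[R]_n)^', h != 0 by exact: nbhs_dnbhs_neq.
apply: filterS2 near_p near_n0 => h ph h0; rewrite /= -EFinB /diff_quot lee_fin sub0r.
have hn : 0 < enorm h by rewrite (lt_le_trans _ (normr_le_enorm h))// normr_gt0.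
rewrite ler_pdivlMr// mulNr.
have le1 := yl (y + h).
rewrite (hopf_lax_costE (y := y + h) t0 (PH _)) in le1.
have le2 := hopf_lax_cost_ge x y (p' h) t0.
rewrite -/(p' h) in le1; rewrite dotrBr dotrDr in le1; rewrite dotrBr in le2.
have : - (e * enorm h) <= dotr (p' h - p) h.
  rewrite lerNl; apply: le_trans (ler_norm _) _; rewrite normrN.
  apply: le_trans (normr_dotr_le _ _) _; rewrite distrC.
  apply: ler_pM => //; last exact: normr_le_enorm.
  apply: le_trans (ler_wpM2l _ ph) _ => //.
  by rewrite mulrCA ler_piMr ?ler_pdivrMr ?mul1r ?ler_nat// ltW.
by rewrite dotrBl; lra.
Qed.

End HopfLax.

(** * Continuous differentiability from first-order expansions *)

Lemma is_diff_eps (R : realType) (V W : normedModType R) (f : V -> W)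
    (df : {linear V -> W}) (x : V) : continuous df ->
  (forall e, 0 < e -> \forall y \near x, `|f y - f x - df (y - x)| <= e * `|y - x|) ->
  differentiable f x /\ 'd f x = df :> (V -> W).
Proof.
move=> dfc fo.
have E : f \o shift x = cst (f x) + df +o_ 0 id.
  apply/eqaddoP => e /fo; rewrite (near_shift 0 x) subr0.
  apply: filterS => h /=.
  by rewrite addrK !fctE /= opprD addrA.
have d := diff_unique dfc E.
by split=> //; apply/diff_locallyP; rewrite d.
Qed.

Lemma C1_on_of_expansion (R : realType) (V : normedModType R) (A : set V)
    (f : V -> R) (df : V -> {linear V -> R}) :
  open A -> (forall x, continuous (df x)) ->
  (forall x, A x -> forall e, 0 < e ->
     \forall y \near x, `|f y - f x - df x (y - x)| <= e * `|y - x|) ->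
  (forall x, A x -> forall e, 0 < e ->
     \forall y \near x, forall v, `|df y v - df x v| <= e * `|v|) ->
  C1_on A f.
Proof.
move=> oA dfc fo dfo.
have dA x : A x -> differentiable f x /\ 'd f x = df x :> (V -> R).
  by move=> Ax; apply: is_diff_eps => // e; exact: fo.
split=> [x /dA[]//|x Ax e e0].
have nA : \forall y \near x, A y by exact: open_nbhs_nbhs.
apply: filterS2 nA (dfo x Ax e e0) => y Ay le v.
by rewrite (dA y Ay).2 (dA x Ax).2.
Qed.

(** Two-sided bounds of an increment by forms a and c that are both close to the
    candidate differential d. *)
Lemma ler_dist_squeeze (R : realDomainType) (u u' a c d e : R) :
  u - u' <= - a -> u' - u <= c ->
  `|a - d| <= e -> `|c - d| <= e -> `|u' - u - d| <= e.
Proof. by rewrite !ler_norml; lra. Qed.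

(** * The differential of the Hopf-Lax solution *)

Section MomentumForm.
Context {R : realType} {n : nat}.

(** For c = H(p) this is the differential of the affine solution
    (t, x) |-> <p, x> - t H(p) of the Hamilton-Jacobi equation. *)
Definition momentum_form (p : 'rV[R]_n) (c : R) (sv : R * 'rV[R]_n) : R :=
  dotr p sv.2 - sv.1 * c.

Lemma momentum_form_is_linear p c : linear (momentum_form p c).
Proof.
move=> a u v; rewrite /momentum_form /= dotrDr dotrZr /GRing.scale /=; ring.
Qed.

HB.instance Definition _ p c :=
  GRing.isLinear.Build R (R * 'rV[R]_n)%type R _ (momentum_form p c)
    (momentum_form_is_linear p c).

Lemma momentum_formN p c v : momentum_form p c (- v) = - momentum_form p c v.
Proof. exact: linearN. Qed.

Lemma momentum_form_continuous p c : continuous (momentum_form p c).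
Proof.
move=> u; apply: (@cvgB _ _ _ (nbhs u)).
  exact: (cvg_comp snd (dotr p) cvg_snd (@dotr_continuous _ _ p _)).
exact: (@cvgM _ _ (nbhs u) _ fst (fun=> c) u.1 c cvg_fst (cvg_cst c)).
Qed.

Lemma momentum_formB_le p c p' c' v :
  `|momentum_form p c v - momentum_form p' c' v|
    <= (n%:R * `|p - p'| + `|c - c'|) * `|v|.
Proof.
have -> : momentum_form p c v - momentum_form p' c' v =
    dotr (p - p') v.2 - v.1 * (c - c').
  by rewrite /momentum_form dotrBl; ring.
rewrite (le_trans (ler_normB _ _))// mulrDl lerD//.
  rewrite (le_trans (normr_dotr_le _ _))// ler_wpM2l ?mulr_ge0//.
  by rewrite prod_normE le_max lexx orbT.
by rewrite normrM mulrC ler_wpM2l// prod_normE le_max lexx.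
Qed.

Lemma momentum_form_near (T : Type) (F : set_system T) {FF : Filter F}
    (H : 'rV[R]_n -> R) (q : T -> 'rV[R]_n) (p : 'rV[R]_n) (e : R) :
  continuous H -> q @ F --> p -> 0 < e ->
  \forall u \near F, forall v,
    `|momentum_form (q u) (H (q u)) v - momentum_form p (H p) v| <= e * `|v|.
Proof.
move=> H_cont qp e0.
have mod0 : n%:R * `|q u - p| + `|H (q u) - H p| @[u --> F] -->
    n%:R * `|p - p| + `|H p - H p|.
  have Hq : H (q u) @[u --> F] --> H p by exact: (cvg_comp q H qp (@H_cont p)).
  have A : n%:R * `|q u - p| @[u --> F] --> n%:R * `|p - p|.
    exact: (@cvgM _ _ F _ (fun=> n%:R) _ _ _ (cvg_cst _) (cvg_norm (cvgB qp (cvg_cst p)))).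
  exact: (cvgD A (cvg_norm (cvgB Hq (cvg_cst (H p))))).
rewrite !subrr !normr0 mulr0 addr0 in mod0.
have : \forall u \near F, n%:R * `|q u - p| + `|H (q u) - H p| < e.
  exact: (cvgr_lt _ mod0).
apply: filterS => u ltu v; apply: le_trans (momentum_formB_le _ _ _ _ _) _.
by rewrite ler_wpM2r// ltW.
Qed.

End MomentumForm.

(** * Regularity where the minimizer is unique *)

Section Regularity.
Context {R : realType} {n : nat} (T : R) (H sigma : 'rV[R]_n -> R).
Hypotheses (H_superlinear : superlinear H) (H_cont : continuous H).
Hypothesis H_convex : strictly_convex H.
Hypothesis hH1 : condH1 T H sigma.
Implicit Types (t : R) (x y : 'rV[R]_n).

Lemma hopf_lax_cost_continuous t x y : 0 < t ->
  {for ((t, x), y), continuous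
    (fun xy : (R * 'rV[R]_n) * 'rV[R]_n => hopf_lax_cost H sigma xy.1.1 xy.1.2 xy.2)}.
Proof.
move=> t0; have [sigma_cont _] := hH1.
have cy : xy.2 @[xy --> ((t, x), y)] --> y by exact: cvg_snd.
have ct : xy.1.1 @[xy --> ((t, x), y)] --> t by apply: cvg_comp cvg_fst _; exact: cvg_fst.
have cx : xy.1.2 @[xy --> ((t, x), y)] --> x by apply: cvg_comp cvg_fst _; exact: cvg_snd.
apply: (@cvgD _ _ _ (nbhs ((t, x), y))).
  exact: (cvg_comp _ sigma cy (@sigma_cont y)).
apply: (@cvgM _ _ (nbhs ((t, x), y)) _ _ _ _ _ ct).
apply: (cvg_comp _ (fenchel H) _ (@fenchel_continuous _ _ _ H_superlinear H_cont H_convex _)).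
by apply: velocity_cvg ct cx cy; rewrite gt_eqF.
Qed.

(** By (H1) the infimum over a fixed ball, attained by compactness, is below the
    cost of every point outside it; so a minimizer over the ball is a global
    one, and no global minimizer lies outside. *)
Lemma ell_locally_bounded t0 x0 : 0 < t0 -> t0 < T ->
  exists N, \forall tx \near (t0, x0),
    ell H sigma tx.1 tx.2 !=set0 /\
    forall y, ell H sigma tx.1 tx.2 y -> enorm y <= N.
Proof.
move=> t0_gt0 t0_ltT; have [_ /(_ t0 x0 (ltW t0_gt0) t0_ltT)] := hH1.
move=> [r [N [r0 N0 HN]]]; exists N.
have ct : tx.1 @[tx --> (t0, x0)] --> t0 by exact: cvg_fst.
have cx : tx.2 @[tx --> (t0, x0)] --> x0 by exact: cvg_snd.
have near_pos : \forall tx \near (t0, x0), 0 < tx.1 by exact: cvgr_gt ct _ t0_gt0.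
have near_T : \forall tx \near (t0, x0), tx.1 < T by exact: cvgr_lt ct _ t0_ltT.
have near_r : \forall tx \near (t0, x0), `|tx.1 - t0| + enorm (tx.2 - x0) < r.
  have : `|tx.1 - t0| + enorm (tx.2 - x0) @[tx --> (t0, x0)] -->
      `|t0 - t0| + enorm (x0 - x0).
    apply: (@cvgD _ _ _ (nbhs (t0, x0))).
      exact: (cvg_norm (cvgB ct (cvg_cst t0))).
    exact: (cvg_comp _ _ (cvgB cx (cvg_cst x0)) (@enorm_continuous _ _ _)).
  rewrite !subrr normr0 add0r /enorm dotr0 sqrtr0 => /cvgr_lt; exact.
near=> tx.
have t_gt0 : 0 < tx.1 by near: tx.
have t_ltT : tx.1 < T by near: tx.
have rlt : `|tx.1 - t0| + enorm (tx.2 - x0) < r by near: tx.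
have {}HN z Nz := HN tx.1 tx.2 z Nz t_gt0 t_ltT rlt.
set S := [set _ | _ in _] in HN.
have B0 : [set y : 'rV[R]_n | enorm y <= N] 0 by rewrite /= /enorm dotr0 sqrtr0 ltW.
have cont : continuous (hopf_lax_cost H sigma tx.1 tx.2).
  move=> y.
  have cy : ((tx.1, tx.2), z) @[z --> y] --> ((tx.1, tx.2), y).
    have Fy : Filter (nbhs y) by exact: nbhs_filter.
    have idy : id @ nbhs y --> y by [].
    exact: (cvg_pair (cvg_cst (tx.1, tx.2)) idy).
  pose cost (xy : (R * 'rV[R]_n) * 'rV[R]_n) := hopf_lax_cost H sigma xy.1.1 xy.1.2 xy.2.
  exact: (cvg_comp _ cost cy (hopf_lax_cost_continuous t_gt0)).
have [|c cN cmin] := EVT_min_rV _ (@compact_enorm_ball R n N) (continuous_subspaceT cont).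
  by exists 0.
have cS : hopf_lax_cost H sigma tx.1 tx.2 c <= inf S.
  apply: lb_le_inf; first by exists (hopf_lax_cost H sigma tx.1 tx.2 0), 0.
  by move=> _ [y yN <-]; apply: cmin; rewrite inE.
split.
  exists c => z; have [zN|/HN Nz] := lerP (enorm z) N; first by apply: cmin; rewrite inE.
  by rewrite (le_trans cS)// ltW.
move=> y yl; rewrite leNgt; apply/negP => /HN.
by apply/negP; rewrite -leNgt (le_trans (yl c)).
Unshelve. all: by end_near. Qed.

Lemma ell_cvg (Y : R * 'rV[R]_n -> 'rV[R]_n) t0 x0 y0 : 0 < t0 -> t0 < T ->
  ell H sigma t0 x0 = [set y0] ->
  (\forall tx \near (t0, x0), ell H sigma tx.1 tx.2 (Y tx)) ->
  Y @ (t0, x0) --> y0.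
Proof.
move=> t0_gt0 t0_ltT ell1 Yl.
have [N HN] := ell_locally_bounded x0 t0_gt0 t0_ltT.
have y0l : ell H sigma t0 x0 y0 by rewrite ell1.
apply: (argmin_cvg (f := fun tx y => hopf_lax_cost H sigma tx.1 tx.2 y)
  (@compact_enorm_ball R n N)).
- by move=> y _; exact: hopf_lax_cost_continuous.
- by apply: filterS2 Yl HN => tx Yl [_ bd]; split; [exact: bd | exact: Yl].
- by have [_] := nbhs_singleton HN; exact.
- move=> y _ le; have : ell H sigma t0 x0 y by move=> z; rewrite (le_trans le)// y0l.
  by rewrite ell1.
Qed.

(** The increment of u from (t, x) to (s, w) is squeezed between two momentum
    forms. The upper one comes from the minimizer of (t, x) used at (s, w), with
    momentum q1; the lower one from the minimizer of (s, w) used at (t, x), with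
    momentum q2. Both momenta tend to p(t, x), since the unique minimizer Y is
    continuous. *)
Lemma hopf_lax_C1 (A : set (R * 'rV[R]_n)) : open A ->
  (forall tx, A tx -> 0 < tx.1 /\ tx.1 < T) ->
  (forall tx y z, A tx -> ell H sigma tx.1 tx.2 y -> ell H sigma tx.1 tx.2 z -> y = z) ->
  C1_on A (hopf_lax H sigma).
Proof.
move=> oA AT uniq.
have [P PH] := choice (fenchel_argmax_exists H_superlinear H_cont).
have P_cont := fenchel_argmax_continuous H_superlinear H_cont H_convex PH.
pose Y (tx : R * 'rV[R]_n) := get (ell H sigma tx.1 tx.2).
have YA tx : A tx -> ell H sigma tx.1 tx.2 (Y tx).
  move=> Atx; have [t_gt0 t_ltT] := AT _ Atx.
  have [N] := ell_locally_bounded tx.2 t_gt0 t_ltT.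
  by rewrite -surjective_pairing => /nbhs_singleton[/getPex].
have Acvg tx : A tx -> Y @ tx --> Y tx.
  move=> Atx; have [t_gt0 t_ltT] := AT _ Atx.
  rewrite [X in Y @ X](surjective_pairing tx); apply: ell_cvg => //.
    apply/seteqP; split=> [y yl|_ ->]; last exact: YA.
    exact: uniq Atx yl (YA _ Atx).
  rewrite -surjective_pairing; apply: filterS YA _.
  exact: open_nbhs_nbhs.
pose p (tx : R * 'rV[R]_n) := P (tx.1^-1 *: (tx.2 - Y tx)).
have pp tx : A tx -> p @ tx --> p tx.
  case: tx => t x Atx; have [t_gt0 _] := AT _ Atx.
  apply: (cvg_comp _ P _ (@P_cont _)).
  apply: (velocity_cvg _ _ _ (Acvg _ Atx)); first by rewrite gt_eqF.
    exact: cvg_fst.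
  exact: cvg_snd.
apply: (@C1_on_of_expansion _ _ A _ (fun tx => momentum_form (p tx) (H (p tx)))) => //.
- by move=> tx; exact: momentum_form_continuous.
- case=> t x Atx e e0; have [t_gt0 t_ltT] := AT _ Atx.
  have ct : y.1 @[y --> (t, x)] --> t by exact: cvg_fst.
  have cx : y.2 @[y --> (t, x)] --> x by exact: cvg_snd.
  pose q1 (y : R * 'rV[R]_n) := P (y.1^-1 *: (y.2 - Y (t, x))).
  pose q2 (y : R * 'rV[R]_n) := P (t^-1 *: (x - Y y)).
  have q1p : q1 @ (t, x) --> p (t, x).
    apply: (cvg_comp _ P _ (@P_cont _)).
    by apply: velocity_cvg ct cx (cvg_cst _); rewrite gt_eqF.
  have q2p : q2 @ (t, x) --> p (t, x).
    apply: (cvg_comp _ P _ (@P_cont _)).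
    by apply: velocity_cvg (cvg_cst _) (cvg_cst _) (Acvg _ Atx); rewrite gt_eqF.
  have nA : \forall y \near (t, x), A y by exact: open_nbhs_nbhs.
  pose close (q : R * 'rV[R]_n -> 'rV[R]_n) (u : R * 'rV[R]_n) := forall v,
    `|momentum_form (q u) (H (q u)) v - momentum_form (p (t, x)) (H (p (t, x))) v|
      <= e * `|v|.
  have n1 : \forall y \near (t, x), close q1 y.
    exact: (@momentum_form_near _ _ _ (nbhs (t, x)) _ H q1 _ e H_cont q1p e0).
  have n2 : \forall y \near (t, x), close q2 y.
    exact: (@momentum_form_near _ _ _ (nbhs (t, x)) _ H q2 _ e H_cont q2p e0).
  apply: filterS3 nA n1 n2 => -[s w] Ay m1 m2.
  have [s_gt0 s_ltT] := AT _ Ay.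
  have up : hopf_lax H sigma (s, w) - hopf_lax H sigma (t, x)
      <= momentum_form (q1 (s, w)) (H (q1 (s, w))) (s - t, w - x).
    exact: hopf_lax_increment_le t_gt0 s_gt0 (YA _ Atx) (YA _ Ay) (PH _).
  have low : hopf_lax H sigma (t, x) - hopf_lax H sigma (s, w)
      <= momentum_form (q2 (s, w)) (H (q2 (s, w))) (- (s - t, w - x)).
    rewrite /momentum_form /= !opprB.
    exact: hopf_lax_increment_le s_gt0 t_gt0 (YA _ Ay) (YA _ Atx) (PH _).
  rewrite momentum_formN in low.
  have -> : (s, w) - (t, x) = (s - t, w - x) by [].
  have := ler_dist_squeeze low up (m2 (s - t, w - x)) (m1 (s - t, w - x)).
  exact.
- move=> tx Atx e e0.
  exact: (@momentum_form_near _ _ _ (nbhs tx) _ H p _ e H_cont (pp _ Atx) e0).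
Qed.

End Regularity.

(** * Type (I) characteristics up to a fixed time *)

Theorem theorem4p3 (R : realType) (n : nat) (T : R) (H sigma : 'rV[R]_n -> R)
  (T_gt0 : 0 < T)
  (hH0 : condH0 H)
  (hH1 : condH1 T H sigma)
  (H_C1 : C1_on [set: 'rV[R]_n] H)
  (tstar : R) (tstar_gt0 : 0 < tstar) (tstar_ltT : tstar < T)
  (all_type_I : forall (x : 'rV[R]_n) (c : R -> 'rV[R]_n),
     gen_char T H sigma c -> c tstar = x -> type_I H sigma c tstar x) :
  C1_on [set tx : R * 'rV[R]_n | 0 < tx.1 /\ tx.1 < tstar] (hopf_lax H sigma).
Proof.
have [H_convex H_superlinear] := hH0.
have dH p : differentiable H p by have [d _] := H_C1; exact: d.
have H_cont : continuous H by move=> p; exact: differentiable_continuous.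
have [P PH] := choice (fenchel_argmax_exists H_superlinear H_cont).
(* The characteristic issued from a minimizer is of type (I) at time tstar. *)
have propagate t x y : 0 < t -> ell H sigma t x y ->
    ell H sigma tstar (y + tstar *: (t^-1 *: (x - y))) y.
  move=> t_gt0 yl; set v := t^-1 *: (x - y).
  have Pv : grad H (P v) = v := fenchel_argmax_grad (dH _) (PH v).
  have Dq : Dsharp sigma y (P v).
    have q : (Dplus sigma y `|` Dminus sigma y) (P v).
      by right; apply: ell_Dminus H_superlinear H_cont H_convex _ PH _ _ _ t_gt0 yl.
    by rewrite /Dsharp; case: asboolP => // -[]; exists (P v).
  have [//||_] := all_type_I (y + tstar *: v) (char_curve H y (P v)).
  - by exists y, (P v).
  - by rewrite /char_curve Pv.
  - by rewrite /char_curve scale0r addr0.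
apply: (hopf_lax_C1 H_superlinear H_cont H_convex hH1).
- rewrite (_ : [set _ | _] = fst @^-1` `]0, tstar[%classic); last first.
    by apply/seteqP; split=> tx /=; rewrite in_itv /= => /andP.
  by apply: open_comp => [tx _|]; [exact: cvg_fst | exact: interval_open].
- by move=> tx [? lt]; split=> //; exact: lt_trans lt tstar_ltT.
- move=> tx y z [t_gt0 t_lt] yl zl.
  exact: (ell_unique H_superlinear H_cont dH t_gt0 t_lt zl (propagate _ _ _ t_gt0 zl) yl).
Qed.
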